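(* Let $\Gamma$ be a minimal bipartite graph on the torus with Newton polygon $N$ (with nonempty interior), and let $\mathscr X_N$ be the toric stack of $N$. Put $$\mathcal E_{\mathrm b}=\mathcal O_{\mathscr X_N}\Bigl(\mathbf D(\mathrm b)-\sum_{\rho\in\Sigma(1)}\sum_{\alpha\in Z_\rho:\mathrm b\in\alpha}\frac1{|E_\rho|}D_\rho\Bigr)\ (\mathrm b\in B),\qquad \mathcal F_{\mathrm w}=\mathcal O_{\mathscr X_N}(\mathbf D(\mathrm w))\ (\mathrm w\in W),$$ $\mathcal E=\bigoplus_{\mathrm b\in B}\mathcal E_{\mathrm b}$ and $\mathcal F=\bigoplus_{\mathrm w\in W}\mathcal F_{\mathrm w}$. Then the Kasteleyn operator $K:\mathbb C[z^{\pm1},w^{\pm1}]^B\to\mathbb C[z^{\pm1},w^{\pm1}]^W$, viewed as a map of trivial sheaves on $\mathrm T$, extends to a map of locally free sheaves on $\mathscr X_N$: $$\widetilde K:\mathcal E\to\mathcal F.$$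
   Context: **Torus, graph, zig-zag paths.** $\mathbb T\cong S^1\times S^1$ is obtained by gluing opposite sides of a fundamental rectangle $R$, whose oriented sides $\gamma_z,\gamma_w$ form a basis of $\mathrm M:=H_1(\mathbb T,\mathbb Z)\cong\mathbb Z^2$ with intersection number $(\gamma_z,\gamma_w)_{\mathbb T}=1$. $\mathrm M^\vee=\mathrm{Hom}_{\mathbb Z}(\mathrm M,\mathbb Z)$, with pairing $\langle *,*\rangle$; $\mathrm M_{\mathbb R}=\mathrm M\otimes\mathbb R$. $\mathrm T=\mathrm{Hom}_{\mathbb Z}(\mathrm M,\mathbb C^\times)\cong(\mathbb C^\times)^2$ has characters $\chi^m$, $m\in\mathrm M$, with $\chi^{i\gamma_z+j\gamma_w}=z^iw^j$. $\Gamma$ is a bipartite graph embedded in $\mathbb T$ with contractible faces; $B,W,E,V$ are its black vertices, white vertices, edges, vertices (vertices lie inside $R$). Edges are oriented from black to white. A zig-zag path is a closed path turning maximally right at black vertices and maximally left at white vertices; it is drawn as a closed curve through midpoints of consecutive edges (a straight cycle of the medial graph), so its black vertices lie on its left and its white vertices on its right. $\mathrm v\in\alpha$ means the zig-zag path $\alpha$ passes through $\mathrm v$. $\Gamma$ is minimal: in the universal cover, lifts of zig-zag paths do not self-intersect and no two lifts form a parallel bigon (two consecutive intersections with both paths oriented from one to the other). For $e=\mathrm b\mathrm w\in E$, let $l_e$ be the loop obtained by concatenating $e$ (from $\mathrm b$ to $\mathrm w$) with a path inside $R$ from $\mathrm w$ to $\mathrm b$, and $\phi(e)=\chi^{[l_e]}$.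 $N\subset\mathrm M_{\mathbb R}$ is the convex hull of the points $\sum_{e\in\mathrm m}[l_e]$ over dimer covers (perfect matchings) $\mathrm m$ of $\Gamma$; its primitive edge vectors in counterclockwise order are the classes $[\alpha]$ of zig-zag paths. $N$ is assumed to have nonempty interior. $\Sigma$ is the normal fan of $N$; for a ray $\rho\in\Sigma(1)$, $E_\rho$ is the edge of $N$ with primitive inward normal $u_\rho\in\rho$, $|E_\rho|$ is the number of primitive integral vectors in $E_\rho$, and $Z_\rho$ is the set of zig-zag paths $\alpha$ with $[\alpha]$ the primitive (counterclockwise) vector along $E_\rho$ (so $\#Z_\rho=|E_\rho|$); $D_\rho$ is the divisor at infinity corresponding to $\rho$. **Kasteleyn operator.** $wt:E\to\mathbb C^\times$ is an edge weight and $\epsilon:E\to\{\pm1\}$ represents a Kasteleyn sign (alternating product around the boundary of a face equals $-1$, resp. $1$, if its number of edges is $\equiv0$, resp. $2$, mod $4$). $K_{\mathrm w\mathrm b}=\sum_{e=\mathrm b\mathrm w}wt(e)\epsilon(e)\phi(e)$ and $K(\delta_{\mathrm b})=\sum_{\mathrm w}K_{\mathrm w\mathrm b}\delta_{\mathrm w}$. **Rational Abel map.** $\mathbf D:V\to\bigoplus_\rho\mathbb Q D_\rho$ is normalized by $\mathbf D(\mathbf w)=0$ at a fixed white vertex $\mathbf w$ and satisfies $\mathbf D(\mathrm v_2)-\mathbf D(\mathrm v_1)=\sum_\rho\sum_{\alpha\in Z_\rho}\frac{(\alpha,\gamma)_R}{|E_\rho|}D_\rho$ for a path $\gamma\subset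 R$ from $\mathrm v_1$ to $\mathrm v_2$, where $(\alpha,\gamma)_R$ counts signed crossings ($+1$ when $\gamma$ crosses $\alpha$ from its right to its left). **Toric stack and its line bundles.** For a cone $\sigma\in\Sigma$ let $\widetilde\sigma=\mathrm{cone}(e_\rho:\rho\in\sigma(1))\subset\mathbb R^{\Sigma(1)}$, and let $U_\Sigma\subset\mathbb C^{\Sigma(1)}$ be the toric variety of the fan generated by the $\widetilde\sigma$, with coordinates $(z_\rho)$. Let $G\subset(\mathbb C^\times)^{\Sigma(1)}$ be the group of $\lambda=(\lambda_\rho)$ with $\prod_\rho\lambda_\rho^{|E_\rho|\langle m,u_\rho\rangle}=1$ for all $m\in\mathrm M$; it acts on $U_\Sigma$ by $\lambda\cdot z=(\lambda_\rho z_\rho)$, and $\mathscr X_N=[U_\Sigma/G]$, a smooth Deligne--Mumford stack containing $\mathrm T=(\mathbb C^\times)^{\Sigma(1)}/G$ as a dense open subset. For integers $b_\rho$, $\mathcal O_{\mathscr X_N}(\sum_\rho\frac{b_\rho}{|E_\rho|}D_\rho)$ is the trivial bundle on $U_\Sigma$ with $G$-linearization $\lambda\cdot(z,t)=(\lambda\cdot z,\,t\prod_\rho\lambda_\rho^{b_\rho})$. It is canonically trivialized over $\mathrm T$; the character $\chi^m$, viewed as a section over $\mathrm T$, corresponds to the invariant function $\prod_\rho z_\rho^{|E_\rho|\langle m,u_\rho\rangle+b_\rho}$, and $H^0$ of the bundle is $\bigoplus\mathbb C\chi^m$ over $m\in\mathrm M$ with $\langle m,u_\rho\rangle\ge-b_\rho/|E_\rho|$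 for all $\rho$. That $K$ extends means that each entry $K_{\mathrm w\mathrm b}$ is the restriction to $\mathrm T$ (under these trivializations) of a global section of $\mathcal Hom(\mathcal E_{\mathrm b},\mathcal F_{\mathrm w})$. *)

(* Defs.v *)
From mathcomp Require Import all_boot all_order all_algebra.
From mathcomp Require Import complex.
From mathcomp Require Import boolp classical_sets reals topology normedtype.

Set Implicit Arguments.
Unset Strict Implicit.
Unset Printing Implicit Defensive.

Import Order.TTheory GRing.Theory Num.Theory.
Import numFieldNormedType.Exports.

Local Open Scope ring_scope.

(* M = H_1(T, Z) in the basis (gamma_z, gamma_w).  The dual lattice is also   *)
(* written int * int, in the dual basis.                                      *)
Notation lattice := (int * int)%type.

Definition pairing (m u : lattice) : int := m.1 * u.1 + m.2 * u.2.

(* ------------------------------------------------------------------------ *)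
(* Bipartite graphs on the torus                                              *)
(* ------------------------------------------------------------------------ *)

(* A bipartite ribbon graph: every vertex carries the cyclic list of its      *)
(* edges in counterclockwise order (multiple edges are allowed).  [loop e] is *)
(* the class [l_e] of the edge e, oriented from black to white, closed up     *)
(* inside the fundamental rectangle R.                                        *)
Record ribbon_graph := RibbonGraph {
  black : finType;
  white : finType;
  edge : finType;
  bl : edge -> black;
  wh : edge -> white;
  bstar : black -> seq edge;
  wstar : white -> seq edge;
  bstar_uniq : forall b, uniq (bstar b);
  wstar_uniq : forall w, uniq (wstar w);
  mem_bstar : forall b e, (e \in bstar b) = (bl e == b);
  mem_wstar : forall w e, (e \in wstar w) = (wh e == w);
  loop : edge -> lattice
}.

Notation vertex G := (black G + white G)%type.

(* (e, true) is e traversed from black to white, (e, false) its reverse.      *)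
Notation dart G := (edge G * bool)%type.

Section Graph.
Variable G : ribbon_graph.
Local Notation vertex := (vertex G).
Local Notation dart := (dart G).

Definition dsrc (d : dart) : vertex :=
  if d.2 then inl (bl d.1) else inr (wh d.1).
Definition dtgt (d : dart) : vertex :=
  if d.2 then inr (wh d.1) else inl (bl d.1).
Definition dclass (d : dart) : lattice :=
  if d.2 then loop d.1 else - loop d.1.

Fixpoint is_walk (u : vertex) (p : seq dart) (v : vertex) : bool :=
  if p is d :: p' then (dsrc d == u) && is_walk (dtgt d) p' v else u == v.

Definition walk_class (p : seq dart) : lattice := \sum_(d <- p) dclass d.

Definition nextb (e : edge G) : edge G := next (bstar (bl e)) e.
Definition prevb (e : edge G) : edge G := prev (bstar (bl e)) e.
Definition nextw (e : edge G) : edge G := next (wstar (wh e)) e.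
Definition prevw (e : edge G) : edge G := prev (wstar (wh e)) e.

(* The boundary of the face on the left of e, traversed from black to white,  *)
(* turns maximally left at each vertex: it runs along e, then backwards along *)
(* prevw e, then along [face_step e].  Faces are the orbits of [face_step];   *)
(* the face on the right of e is the orbit of [nextw e].                      *)
Definition face_step (e : edge G) : edge G := prevb (prevw e).

Definition cycle1 (x : edge G -> int) : Prop :=
  (forall b, \sum_(e | bl e == b) x e = 0) /\
  (forall w, \sum_(e | wh e == w) x e = 0).

Definition cycle_class (x : edge G -> int) : lattice := \sum_e loop e *~ x e.

Definition face_chain (n : edge G -> int) : Prop :=
  forall e, n (face_step e) = n e.
Definition boundary (n : edge G -> int) : edge G -> int :=
  fun e => n e - n (nextw e).

(* Twice the intersection number of two cycles of a ribbon graph: the sum     *)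
(* over the vertices v of \sum_(i < j) (x_i y_j - x_j y_i), where 1, 2, ...   *)
(* number the edges at v counterclockwise.  (An eastward x crossed by a       *)
(* northward y at a 4-valent vertex contributes 2, so x . y = 1 when y        *)
(* crosses x from right to left.)                                             *)
Definition intersection2 (x y : edge G -> int) : int :=
  \sum_(e : edge G) \sum_(f : edge G |
      (bl f == bl e) && (index e (bstar (bl e)) < index f (bstar (bl e)))%N)
    (x e * y f - x f * y e) +
  \sum_(e : edge G) \sum_(f : edge G |
      (wh f == wh e) && (index e (wstar (wh e)) < index f (wstar (wh e)))%N)
    (x e * y f - x f * y e).

(* Gluing a disc along every face gives a closed oriented surface.  The       *)
(* conditions say that it is connected and that [loop] induces an isomorphism *)
(* from its first homology (cycles modulo boundaries) onto the lattice, for   *)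
(* which (gamma_z, gamma_w) is a basis with intersection number 1; hence the  *)
(* surface is a torus and the graph is embedded in it with contractible       *)
(* faces.  As vertices can be moved by an isotopy, every such [loop] arises   *)
(* from a fundamental rectangle containing the vertices.                      *)
Record embedded_in_torus : Prop := EmbeddedInTorus {
  torus_connected : forall u v : vertex, exists p, is_walk u p v;
  torus_boundary : forall n, face_chain n -> cycle_class (boundary n) = 0;
  torus_exact : forall x, cycle1 x -> cycle_class x = 0 ->
    exists2 n, face_chain n & x =1 boundary n;
  torus_basis : exists gz gw : edge G -> int,
    [/\ cycle1 gz /\ cycle1 gw, cycle_class gz = (1, 0),
        cycle_class gw = (0, 1) & intersection2 gz gw = 2]
}.

(* ------------------------------------------------------------------------ *)
(* Zig-zag paths and minimality                                               *)
(* ------------------------------------------------------------------------ *)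

Definition zigzag_step (d : dart) : dart :=
  if d.2 then (prevw d.1, false) else (nextb d.1, true).

Definition zigzags : {set {set dart}} :=
  [set [set d' | fconnect zigzag_step d d'] | d : dart].

Definition zclass (a : {set dart}) : lattice := \sum_(d in a) dclass d.

Definition visits (a : {set dart}) (v : vertex) : bool :=
  [exists d in a, dsrc d == v].

(* Signed crossings of a walk with the zig-zag path a, drawn through the      *)
(* midpoints of its edges.  Black vertices are on the left of a, so a walk    *)
(* going along e from black to white crosses from left to right every strand  *)
(* of a through e.                                                            *)
Definition passes (a : {set dart}) (e : edge G) : int :=
  ((e, true) \in a)%:Z + ((e, false) \in a)%:Z.
Definition crossings (a : {set dart}) (p : seq dart) : int :=
  \sum_(d <- p) (if d.2 then - passes a d.1 else passes a d.1).

(* In the universal cover, the pair of a dart on the edge e and of m in M is  *)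
(* the dart above it whose black end is in the m-th translate of R; the white *)
(* end is then in the translate by m + loop e.                                *)
Definition ldart : Type := (dart * lattice)%type.

Definition lift_step (x : ldart) : ldart :=
  let d := zigzag_step x.1 in
  (d, if x.1.2 then x.2 + loop x.1.1 - loop d.1 else x.2).

Definition same_lift (x y : ldart) : Prop :=
  (exists n, iter n lift_step x = y) \/ (exists n, iter n lift_step y = x).

(* Two zig-zag strands go through each edge of the universal cover, one in    *)
(* each direction; they intersect at its midpoint.                            *)
Definition flip (x : ldart) : ldart := ((x.1.1, ~~ x.1.2), x.2).

Definition self_intersection (x : ldart) : Prop := same_lift x (flip x).

(* The lifts through x and through flip x intersect at x and at y, which are  *)
(* consecutive intersections along the first one, and both lifts are oriented *)
(* from x to y.                                                               *)
Definition parallel_bigon (x y : ldart) : Prop :=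
  exists i j : nat,
    [/\ y <> x, iter i lift_step x = y, iter j lift_step (flip x) = flip y &
        forall k, (0 < k < i)%N ->
          ~ same_lift (flip x) (flip (iter k lift_step x))].

Definition minimal : Prop :=
  (forall x, ~ self_intersection x) /\ (forall x y, ~ parallel_bigon x y).

(* ------------------------------------------------------------------------ *)
(* Dimer covers and the Newton polygon                                        *)
(* ------------------------------------------------------------------------ *)

Definition dimer_cover (m : {set edge G}) : bool :=
  [forall b, #|[set e in m | bl e == b]| == 1%N] &&
  [forall w, #|[set e in m | wh e == w]| == 1%N].

Definition dimer_class (m : {set edge G}) : lattice := \sum_(e in m) loop e.

End Graph.

Section Polygon.
Variable R : realType.
Local Open Scope classical_set_scope.

Definition real_vec (m : lattice) : R * R := (m.1%:~R, m.2%:~R).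

Definition rpairing (x u : R * R) : R := x.1 * u.1 + x.2 * u.2.

Definition newton_polygon (G : ribbon_graph) : set (R * R) :=
  [set x | exists c : {set edge G} -> R,
    [/\ forall m, dimer_cover m -> 0 <= c m,
        \sum_(m | dimer_cover m) c m = 1,
        x.1 = \sum_(m | dimer_cover m) c m * (real_vec (dimer_class m)).1 &
        x.2 = \sum_(m | dimer_cover m) c m * (real_vec (dimer_class m)).2]].

(* The face of N on which the functional u is minimal.                        *)
Definition face (N : set (R * R)) (u : R * R) : set (R * R) :=
  [set x | N x /\ forall y, N y -> rpairing x u <= rpairing y u].

(* The counterclockwise direction of an edge with inward normal u.            *)
Definition ccw_dir (u : lattice) : lattice := (u.2, - u.1).

Definition lattice_segment (p v : lattice) : set (R * R) :=
  [set x | exists2 t : R, 0 <= t <= 1 &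
    x = (p.1%:~R + t * v.1%:~R, p.2%:~R + t * v.2%:~R)].

(* The rays rho of the normal fan of N, enumerated without repetition, with   *)
(* ray rho = u_rho and elen rho = |E_rho|.                                    *)
Record normal_fan (N : set (R * R)) := NormalFan {
  nrays : nat;
  ray : 'I_nrays -> lattice;
  elen : 'I_nrays -> nat;
  ray_inj : injective ray;
  rayP : forall u : lattice,
    (exists rho, ray rho = u) <->
    coprimez u.1 u.2 /\
    exists x y, [/\ x <> y, face N (real_vec u) x & face N (real_vec u) y];
  elenP : forall rho, exists p : lattice,
    face N (real_vec (ray rho)) =
      lattice_segment p (ccw_dir (ray rho) *+ elen rho)
}.

End Polygon.

Arguments newton_polygon : clear implicits.
Arguments ray {R N}.
Arguments elen {R N}.

(* ------------------------------------------------------------------------ *)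
(* The toric stack X_N and its line bundles                                   *)
(* ------------------------------------------------------------------------ *)

Section Stack.
Variables (R : realType) (N : set (R * R)) (S : normal_fan N).
Local Notation n := (nrays S).

(* [sigma] is the set of rays sigma(1) of a cone sigma of the normal fan.  A  *)
(* cone of the fan consists of the functionals that are minimal on a given    *)
(* face of N.                                                                 *)
Definition fan_cone (sigma : {set 'I_n}) : Prop :=
  exists v : R * R, forall rho,
    rho \in sigma <->
    (face N v `<=` face N (real_vec R (ray S rho)))%classic.

Definition point : Type := {ffun 'I_n -> R[i]}.

Definition in_chart (sigma : {set 'I_n}) (z : point) : Prop :=
  forall rho, rho \notin sigma -> z rho != 0.

Definition in_U (z : point) : Prop :=
  exists2 sigma, fan_cone sigma & in_chart sigma z.

Definition in_torus (z : point) : Prop := forall rho, z rho != 0.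

Definition monomial (k : 'I_n -> int) (z : point) : R[i] :=
  \prod_rho z rho ^ k rho.

(* Regular functions on U_Sigma.  The coordinate ring of the chart of sigma   *)
(* is spanned by the Laurent monomials with nonnegative exponents along the   *)
(* rays of sigma.                                                             *)
Definition regular (f : point -> R[i]) : Prop :=
  forall sigma, fan_cone sigma ->
  exists s : seq (R[i] * {ffun 'I_n -> int}),
    all (fun ck : R[i] * {ffun 'I_n -> int} =>
           [forall rho in sigma, 0 <= ck.2 rho]) s /\
    forall z, in_chart sigma z ->
      f z = \sum_(ck <- s) ck.1 * monomial ck.2 z.

Definition in_G (lam : point) : Prop :=
  in_torus lam /\
  forall m : lattice,
    monomial (fun rho => (elen S rho)%:Z * pairing m (ray S rho)) lam = 1.

Definition scale (lam z : point) : point := [ffun rho => lam rho * z rho].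

Definition divisor : Type := 'I_n -> rat.

(* b is the linearization weight of the line bundle O(D), whose linearization *)
(* is lam . (z, t) = (lam . z, t * monomial b lam); it is only defined when   *)
(* D has the form \sum_rho b_rho / |E_rho| D_rho.                             *)
Definition weight_of (D : divisor) (b : 'I_n -> int) : Prop :=
  forall rho, D rho = (b rho)%:~R / (elen S rho)%:R.

(* Global sections of Hom(O(b), O(b')): the map (z, t) |-> (z, f z * t)       *)
(* commutes with the linearizations.                                          *)
Definition hom_section (b b' : 'I_n -> int) (f : point -> R[i]) : Prop :=
  regular f /\
  forall lam z, in_G lam -> in_U z ->
    f (scale lam z) * monomial b lam = monomial b' lam * f z.

(* Points of T = Hom(M, C^x), in the coordinates z, w.                        *)
Definition tpoint : Type := (R[i] * R[i])%type.

Definition chi (m : lattice) (t : tpoint) : R[i] := t.1 ^ m.1 * t.2 ^ m.2.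

(* The quotient map from the open torus of U_Sigma to T.                      *)
Definition to_T (z : point) : tpoint :=
  (monomial (fun rho => (elen S rho)%:Z * pairing (1, 0) (ray S rho)) z,
   monomial (fun rho => (elen S rho)%:Z * pairing (0, 1) (ray S rho)) z).

(* Over T, the trivializing section of O(b) is monomial b, so that the entry  *)
(* K w b corresponds to the map between the trivial bundles on the open torus *)
(* of U_Sigma sending monomial (eb b) to K w b times monomial (fw w).         *)
Definition extends (B W : finType) (EE : B -> divisor) (FF : W -> divisor)
    (K : W -> B -> tpoint -> R[i]) : Prop :=
  exists (eb : B -> 'I_n -> int) (fw : W -> 'I_n -> int),
    [/\ forall b, weight_of (EE b) (eb b),
        forall w, weight_of (FF w) (fw w) &
        exists Kt : W -> B -> point -> R[i],
          (forall w b, hom_section (eb b) (fw w) (Kt w b)) /\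
          (forall w b z, in_torus z ->
             Kt w b z * monomial (eb b) z =
             K w b (to_T z) * monomial (fw w) z)].

End Stack.

(* ------------------------------------------------------------------------ *)
(* The Kasteleyn operator and the rational Abel map                           *)
(* ------------------------------------------------------------------------ *)

Section Kasteleyn.
Variables (R : realType) (G : ribbon_graph).

(* The face through e has twice as many edges as the orbit of e under         *)
(* [face_step], so its number of edges is 0 mod 4 iff that orbit is even.     *)
Definition kasteleyn_sign (eps : edge G -> R[i]) : Prop :=
  (forall e, eps e = 1 \/ eps e = -1) /\
  forall e, \prod_(f | fconnect (@face_step G) e f) (eps f / eps (prevw f)) =
            (-1) ^+ (fingraph.order (@face_step G) e).+1.

Definition kasteleyn (wt eps : edge G -> R[i]) (w : white G) (b : black G)
    (t : tpoint R) : R[i] :=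
  \sum_(e | (bl e == b) && (wh e == w)) wt e * eps e * chi (loop e) t.

Variable S : normal_fan (newton_polygon R G).
Local Notation n := (nrays S).

(* The primitive edge vectors of the Newton polygon are the classes of the    *)
(* zig-zag paths, with multiplicity.                                          *)
Definition edge_vectors_are_zigzags : Prop :=
  forall v : lattice,
    #|[set a in zigzags G | zclass a == v]| =
    (\sum_(rho < n | ccw_dir (ray S rho) == v) elen S rho)%N.

Definition Z_rho (rho : 'I_n) : {set {set dart G}} :=
  [set a in zigzags G | zclass a == ccw_dir (ray S rho)].

(* A walk of class 0 lifts to a walk in the universal cover with both ends in *)
(* the same translate of R, hence is homotopic to a path inside R.            *)
Definition abel_map (w0 : white G) (D : vertex G -> divisor S) : Prop :=
  (forall rho, D (inr w0) rho = 0) /\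
  forall v1 v2 p, is_walk v1 p v2 -> walk_class p = 0 ->
    forall rho, D v2 rho - D v1 rho =
      \sum_(a in Z_rho rho) (crossings a p)%:~R / (elen S rho)%:R.

Definition calE (D : vertex G -> divisor S) (b : black G) : divisor S :=
  fun rho => D (inl b) rho -
    \sum_(a in Z_rho rho | visits a (inl b)) 1 / (elen S rho)%:R.

Definition calF (D : vertex G -> divisor S) (w : white G) : divisor S :=
  D (inr w).

End Kasteleyn.

(* Main.v *)
Require Import Defs.
From mathcomp Require Import all_boot all_order all_algebra.
From mathcomp Require Import complex.
From mathcomp Require Import boolp classical_sets reals topology normedtype.
From mathcomp Require Import zify ring.
Import numFieldNormedType.Exports.
Import Order.TTheory GRing.Theory Num.Theory.
Local Open Scope ring_scope.
Set Implicit Arguments.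
Unset Strict Implicit.
Unset Printing Implicit Defensive.

(** An entry of the Kasteleyn matrix is a sum, over the edges e from b to w, of
    multiples of the characters of weight [loop e].  In the coordinates of
    U_Sigma, between the bundles with weights eb (of E_b) and fw (of F_w), such a
    term is the monomial with exponents
    |E_rho| <l_e, u_rho> + fw_rho - eb_rho, so it suffices that these integers
    are nonnegative: a Laurent polynomial with nonnegative exponents is regular
    on every chart, and its equivariance is built into the exponents
    ([hom_section_laurent]).

    The weights come from the Abel map: since the homology of the graph is the
    whole lattice, each vertex is reached from the base vertex by a walk of
    class 0 ([walk_of_class]), and the signed crossings of that walk with the
    zig-zag paths of Z_rho add up to |E_rho| times the Abel map.  Let p and q be
    such walks to b and to w.  Then p, followed by e, followed by q backwards, is
    a closed walk of class l_e, and its crossing number with a zig-zag path a is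
    the intersection number of [a] with l_e ([zigzag_crossings]), which is
    <l_e, u_rho> when [a] is the counterclockwise direction along E_rho.  As Z_rho
    has |E_rho| elements, these contributions cancel |E_rho| <l_e, u_rho>, and the
    exponent is the number of a in Z_rho visiting b minus the number of strands
    of such a through e ([edge_exponent_ge0]).  A zig-zag path through e visits
    b, and by minimality it runs through e only once ([passes_le1]).

    The intersection formula rests on the combinatorial intersection number.
    Both a zig-zag path and the boundary of a chain of faces are, around each
    vertex, differences of a function of the edges between consecutive edges,
    and for such chains the local intersection form telescopes
    ([star_form_turn]).  For boundaries the result is 0, so the form descends to
    homology, where it is the determinant ([intersection2_class]); for a zig-zag
    path it is minus twice the signed number of its strands crossed by the other
    cycle ([intersection2_zigzag]). *)

(** * The intersection form around the vertices *)

(** Cutting the cyclic list at its head, each of the two sums telescopes between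
    f and the head. *)
Lemma star_telescope (E : eqType) (s : seq E) (g : E -> int) (f : E) :
  uniq s -> f \in s ->
  \sum_(e <- s | (index e s < index f s)%N) (g e - g (next s e)) -
  \sum_(e <- s | (index f s < index e s)%N) (g e - g (next s e)) =
  g (head f s) *+ 2 - (g f + g (next s f)).
Proof.
move=> Us fs; have szs : (index f s < size s)%N by rewrite index_mem.
case: s Us fs szs => // x0 s'; set s := x0 :: s' => Us fs szs.
(* The default value x0 is the head of s, so that G (size s) = G 0 and the last
   element of s is followed by the first one. *)
pose G i := g (nth x0 s i).
have next_s i : (i < size s)%N -> next s (nth x0 s i) = nth x0 s i.+1.
  by move=> lt_i; rewrite next_nth mem_nth // -/s index_uniq.
have sumE (P : pred nat) :
    \sum_(e <- s | P (index e s)) (g e - g (next s e)) =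
    - \sum_(0 <= i < size s | P i) (G i.+1 - G i).
  rewrite (big_nth x0) -sumrN big_nat_cond [RHS]big_nat_cond.
  apply: eq_big => [i | i /andP[lt_i _]].
    by apply: andb_id2l => lt_i; rewrite index_uniq.
  by rewrite next_s // opprB.
rewrite (sumE (fun i => i < index f s)%N) (sumE (fun i => index f s < i)%N).
rewrite -(big_nat_widen 0 (index f s) (size s) xpredT) 1?ltnW //.
rewrite -(big_nat_widenl (index f s).+1 0 (size s) xpredT) //.
rewrite !telescope_sumr // /G (nth_default x0 (leqnn (size s))).
rewrite -[in next s f](nth_index x0 fs).
by rewrite next_s // nth_index //=; ring.
Qed.

Section StarForm.
Variables (E T : finType) (h : E -> T) (star : T -> seq E).
Hypotheses (star_uniq : forall v, uniq (star v))
  (mem_star : forall v e, (e \in star v) = (h e == v)).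

(** The contribution of one colour of vertices to [intersection2]: h is the end
    of an edge and star the cyclic list of the edges at a vertex. *)
Definition star_form (x y : E -> int) : int :=
  \sum_(e : E) \sum_(f : E |
      (h f == h e) && (index e (star (h e)) < index f (star (h e)))%N)
    (x e * y f - x f * y e).

Definition rotate (e : E) : E := next (star (h e)) e.

Lemma rotate_vertex e : h (rotate e) = h e.
Proof. by apply/eqP; rewrite -mem_star mem_next mem_star. Qed.

Lemma rotate_inj : injective rotate.
Proof.
move=> e f eq_ef; have eq_h : h e = h f.
  by rewrite -rotate_vertex eq_ef rotate_vertex.
apply: (can_inj (prev_next (star_uniq (h e)))).
by rewrite [LHS]eq_ef /rotate eq_h.
Qed.

Lemma sum_turn (g : E -> int) v :
  \sum_(e | h e == v) (g e - g (rotate e)) = 0.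
Proof.
rewrite sumrB (reindex_inj rotate_inj) /=.
by under eq_bigl do rewrite rotate_vertex; rewrite subrr.
Qed.

Lemma star_form_anti x y : star_form x y = - star_form y x.
Proof.
rewrite /star_form -sumrN; apply: eq_bigr => e _.
by rewrite -sumrN; apply: eq_bigr => f _; ring.
Qed.

Lemma star_form_lin a b (x1 x2 x3 x y : E -> int) :
  (forall e, x e = a * x1 e + b * x2 e + x3 e) ->
  star_form x y = a * star_form x1 y + b * star_form x2 y + star_form x3 y.
Proof.
move=> xE; rewrite /star_form !mulr_sumr -!big_split; apply: eq_bigr => e _ /=.
rewrite !mulr_sumr -!big_split; apply: eq_bigr => f _ /=.
by rewrite !xE; ring.
Qed.

(** The coefficient of y f is given by [star_telescope]; it contains the value of
    g at the head of the star, which depends on the position of the cut, but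
    this value is the same for all the edges at a vertex and disappears because
    y has no divergence there. *)
Lemma star_form_turn (g y : E -> int) :
  (forall v, \sum_(e | h e == v) y e = 0) ->
  star_form (fun e => g e - g (rotate e)) y =
  - \sum_e y e * (g e + g (rotate e)).
Proof.
move=> y0; set x := fun e => _.
have coef f : (\sum_(e | (h f == h e) &&
                  (index e (star (h e)) < index f (star (h e)))%N) x e -
    \sum_(e | (h e == h f) &&
                  (index f (star (h f)) < index e (star (h f)))%N) x e) =
    g (head f (star (h f))) *+ 2 - (g f + g (rotate f)).
  rewrite -star_telescope ?mem_star // -[X in _ = X - _]big_filter.
  rewrite -[X in _ = _ - X]big_filter.
  rewrite !big_uniq ?filter_uniq //=.
  congr (_ - _); apply: eq_big => e.
  - rewrite mem_filter mem_star andbC eq_sym.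
    by apply: andb_id2r => /eqP ->.
  - by case/andP=> /eqP hfe _; rewrite /x /rotate hfe.
  - by rewrite mem_filter mem_star andbC.
  - by case/andP=> /eqP hfe _; rewrite /x /rotate hfe.
transitivity (\sum_f y f *
    (g (head f (star (h f))) *+ 2 - (g f + g (rotate f)))).
  rewrite /star_form; under eq_bigr do rewrite sumrB.
  rewrite sumrB (exchange_big_dep xpredT) //= -sumrB; apply: eq_bigr => f _.
  rewrite -coef mulrBr !mulr_sumr.
  by congr (_ - _); apply: eq_bigr => e _; ring.
under eq_bigr do rewrite mulrBr.
rewrite sumrB (partition_big h xpredT) //= big1 ?sub0r // => v _.
case: (pickP (fun e => h e == v)) => [e0 /eqP he0 | no_e].
  2: by rewrite big_pred0.
transitivity ((\sum_(e | h e == v) y e) * (g (head e0 (star v)) *+ 2)).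
  2: by rewrite y0 mul0r.
rewrite mulr_suml; apply: eq_bigr => e /eqP he; rewrite he.
(* The star of v is nonempty, so its head does not depend on the default. *)
congr (y e * (g _ *+ 2)).
have : e0 \in star v by rewrite mem_star he0.
by case: (star v).
Qed.

End StarForm.

(** * The intersection number on homology *)

Lemma lattice_mulrz (u : lattice) (a : int) : u *~ a = (u.1 * a, u.2 * a).
Proof.
case: u => p q; apply/eqP; rewrite /eq_op /=.
by rewrite (raddfMz (@fst int int)) (raddfMz (@snd int int)) /= !mulrzz !eqxx.
Qed.

Section Intersection.
Variable G : ribbon_graph.
Implicit Types (x y g n : edge G -> int).

Lemma intersection2E x y :
  intersection2 x y = star_form (@bl G) (@bstar G) x y +
                      star_form (@wh G) (@wstar G) x y.
Proof. by []. Qed.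

Lemma bl_nextb e : bl (@nextb G e) = bl e.
Proof. exact: (rotate_vertex (@mem_bstar G)). Qed.

Lemma wh_nextw e : wh (@nextw G e) = wh e.
Proof. exact: (rotate_vertex (@mem_wstar G)). Qed.

Lemma prevbK : cancel (@prevb G) (@nextb G).
Proof.
move=> e; have bl_prevb : bl (prevb e) = bl e.
  by apply/eqP; rewrite -mem_bstar mem_prev mem_bstar.
by rewrite /nextb bl_prevb next_prev // bstar_uniq.
Qed.

Lemma prevwK : cancel (@prevw G) (@nextw G).
Proof.
move=> e; have wh_prevw : wh (prevw e) = wh e.
  by apply/eqP; rewrite -mem_wstar mem_prev mem_wstar.
by rewrite /nextw wh_prevw next_prev // wstar_uniq.
Qed.

Lemma nextbK : cancel (@nextb G) (@prevb G).
Proof. by move=> e; rewrite /prevb bl_nextb /nextb prev_next // bstar_uniq. Qed.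

Lemma nextwK : cancel (@nextw G) (@prevw G).
Proof. by move=> e; rewrite /prevw wh_nextw /nextw prev_next // wstar_uniq. Qed.

Lemma intersection2_anti x y : intersection2 x y = - intersection2 y x.
Proof.
rewrite !intersection2E (star_form_anti _ _ x) [X in _ + X]star_form_anti.
by rewrite -opprD.
Qed.

Lemma intersection2_lin a b (x1 x2 x3 x y : edge G -> int) :
  (forall e, x e = a * x1 e + b * x2 e + x3 e) ->
  intersection2 x y =
  a * intersection2 x1 y + b * intersection2 x2 y + intersection2 x3 y.
Proof.
by move=> xE; rewrite !intersection2E !(star_form_lin _ _ _ xE); ring.
Qed.

(** A function n that is constant on faces satisfies n (nextw e) = n (prevb e):
    both are the face on the right of e.  Hence the boundary of n is a
    difference along the rotation at the white vertices with g = n, and at the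
    black vertices with g = - n \o prevb; the two contributions given by
    [star_form_turn] are opposite. *)
Lemma intersection2_boundary n y : face_chain n -> cycle1 y ->
  intersection2 (boundary n) y = 0.
Proof.
move=> n_face [yb yw]; rewrite intersection2E.
have -> : boundary n = fun e => n e - n (rotate (@wh G) (@wstar G) e) by [].
rewrite [X in _ + X](star_form_turn (@wstar_uniq G) (@mem_wstar G)) //.
have -> : (fun e => n e - n (rotate (@wh G) (@wstar G) e)) =
    fun e => - n (prevb e) - - n (prevb (rotate (@bl G) (@bstar G) e)).
  apply: funext => e; rewrite -[rotate (@bl G) _ e]/(nextb e) nextbK.
  rewrite -[rotate _ _ e]/(nextw e) -(n_face (nextw e)) /face_step nextwK.
  by rewrite opprK addrC.
rewrite (star_form_turn (@bstar_uniq G) (@mem_bstar G)) // -opprD -big_split.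
rewrite big1 ?oppr0 // => e _ /=.
rewrite -[rotate _ _ e]/(nextb e) -[rotate _ _ e]/(nextw e) nextbK.
by rewrite -(n_face (nextw e)) /face_step nextwK; ring.
Qed.

(** The intersection number of two homology classes, for which (1, 0) and (0, 1)
    have intersection number 1. *)
Definition cross (u v : lattice) : int := u.1 * v.2 - u.2 * v.1.

Lemma cycle_class_lin a b (x1 x2 x3 x : edge G -> int) :
  (forall e, x e = a * x1 e + b * x2 e + x3 e) ->
  cycle_class x = cycle_class x1 *~ a + cycle_class x2 *~ b + cycle_class x3.
Proof.
move=> xE; rewrite /cycle_class !mulrz_suml -!big_split; apply: eq_bigr => e _ /=.
by rewrite xE !mulrzDr -!mulrzA ![_ * a]mulrC ![_ * b]mulrC.
Qed.

Hypothesis torusG : embedded_in_torus G.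

(** Modulo boundaries, every cycle is an integral combination of gz and gw, and
    the form is alternating, so it is determined by its value on (gz, gw). *)
Lemma intersection2_class x y : cycle1 x -> cycle1 y ->
  intersection2 x y = 2 * cross (cycle_class x) (cycle_class y).
Proof.
case: (torus_basis torusG) => gz [gw [[cz cw] zE wE zw2]].
have expand x' y' : cycle1 x' -> cycle1 y' -> intersection2 x' y' =
    (cycle_class x').1 * intersection2 gz y' +
    (cycle_class x').2 * intersection2 gw y'.
  move=> cx cy; set c1 := _.1; set c2 := _.2.
  pose r e := x' e - (c1 * gz e + c2 * gw e).
  have rE e : r e = - c1 * gz e + - c2 * gw e + x' e by rewrite /r; ring.
  have xE e : x' e = c1 * gz e + c2 * gw e + r e by rewrite /r; ring.
  have cr : cycle1 r.
    case: cx cz cw => xb xw [zb zw] [wb ww].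
    by split=> v; under eq_bigr do rewrite rE; rewrite !big_split -!mulr_sumr /=
      ?xb ?zb ?wb ?xw ?zw ?ww !mulr0 !addr0.
  have r0 : cycle_class r = 0.
    rewrite (cycle_class_lin rE) zE wE /c1 /c2.
    rewrite !lattice_mulrz; case: (cycle_class x') => p q /=.
    by congr pair; rewrite /=; ring.
  have [n n_face rn] := torus_exact torusG cr r0.
  rewrite (intersection2_lin _ xE) (_ : r = boundary n); last exact: funext.
  by rewrite intersection2_boundary // addr0.
have self0 x' : intersection2 x' x' = 0.
  by have := intersection2_anti x' x'; lia.
move=> cx cy; rewrite (expand x y) // (intersection2_anti gz).
rewrite (intersection2_anti gw) (expand y gz) // (expand y gw) // !self0.
by rewrite (intersection2_anti gw gz) zw2 /cross; ring.
Qed.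

End Intersection.

(** * Walks and their classes *)

Section Walks.
Variable G : ribbon_graph.
Implicit Types (u v : vertex G) (p q : seq (dart G)).

(** Signed sum of F along a walk: the class of a walk and its crossings with a
    zig-zag path are both of this form, so both only depend on its chain. *)
Definition walk_sum (V : zmodType) (F : edge G -> V) p : V :=
  \sum_(d <- p) (if d.2 then F d.1 else - F d.1).

Definition rev_walk p : seq (dart G) := [seq (d.1, ~~ d.2) | d <- rev p].

Definition walk_chain p : edge G -> int :=
  fun e => walk_sum (fun f => (f == e)%:Z) p.

Lemma walk_sum_cat (V : zmodType) (F : edge G -> V) p q :
  walk_sum F (p ++ q) = walk_sum F p + walk_sum F q.
Proof. exact: big_cat. Qed.

Lemma walk_sum_rev (V : zmodType) (F : edge G -> V) p :
  walk_sum F (rev_walk p) = - walk_sum F p.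
Proof.
rewrite /walk_sum big_map -sumrN; rewrite (perm_big p) ?perm_rev //=.
by apply: eq_bigr => -[e []] _ /=; rewrite ?opprK.
Qed.

Lemma walk_sum_edge (V : zmodType) (F : edge G -> V) e :
  walk_sum F [:: (e, true)] = F e.
Proof. exact: big_seq1. Qed.

Lemma is_walk_cat p q u v w :
  is_walk u p v -> is_walk v q w -> is_walk u (p ++ q) w.
Proof.
elim: p u => [u /eqP -> // | d p IHp u /= /andP[-> walk_p] walk_q].
exact: IHp.
Qed.

Lemma is_walk_rev p u v : is_walk u p v -> is_walk v (rev_walk p) u.
Proof.
elim: p u => [u /eqP -> /= // | d p IHp u /= /andP[/eqP <- /IHp walk_p]].
rewrite /rev_walk rev_cons map_rcons -cats1; apply: is_walk_cat walk_p _.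
by case: d => e []; rewrite /= !eqxx.
Qed.

Lemma is_walk_edge (e : edge G) : is_walk (inl (bl e)) [:: (e, true)] (inr (wh e)).
Proof. by rewrite /= !eqxx. Qed.

Lemma walk_sum_chain (V : zmodType) (F : edge G -> V) p :
  walk_sum F p = \sum_e F e *~ walk_chain p e.
Proof.
under eq_bigr do rewrite /walk_chain /walk_sum mulrz_sumr.
rewrite exchange_big; apply: eq_bigr => -[f b] _ /=.
rewrite (bigD1 f) //= eqxx big1 => [|e ne]; last first.
  by rewrite eq_sym (negPf ne); case: b; rewrite ?oppr0 mulr0z.
by case: b; rewrite ?mulrNz mulr1z addr0.
Qed.

(** Each coefficient of the divergence is the variation along the walk of the
    indicator function of a vertex. *)
Lemma walk_chain_cycle p u : is_walk u p u -> cycle1 (walk_chain p).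
Proof.
have potential (phi : vertex G -> int) v :
    is_walk u p v -> \sum_(d <- p) (phi (dtgt d) - phi (dsrc d)) = phi v - phi u.
  elim: p u => [u0 /eqP -> | d p IHp u0 /= /andP[/eqP <- /IHp walk_p]].
    by rewrite big_nil subrr.
  by rewrite big_cons walk_p; ring.
move=> walk_p; have sum_chain (P : pred (edge G)) :
    \sum_(e | P e) walk_chain p e = walk_sum (fun e => (P e)%:Z) p.
  rewrite walk_sum_chain big_mkcond; apply: eq_bigr => e _.
  by case: (P e); rewrite ?intz ?mul0rz // mulrzz mul1r.
split=> [b | w]; rewrite sum_chain /walk_sum.
- rewrite -[RHS](subrr (- (u == inl b :> vertex G)%:Z)).
  rewrite -(potential (fun v => - (v == inl b)%:Z)) //.
  by apply: eq_bigr => -[e []] _; rewrite /dtgt /dsrc //=; ring.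
- rewrite -[RHS](subrr (u == inr w :> vertex G)%:Z).
  rewrite -(potential (fun v => (v == inr w)%:Z)) //.
  by apply: eq_bigr => -[e []] _; rewrite /dtgt /dsrc //=; ring.
Qed.

Lemma walk_classE p : walk_class p = walk_sum (@loop G) p.
Proof. by []. Qed.

Lemma crossingsE a p : crossings a p = - walk_sum (passes a) p.
Proof.
rewrite /crossings /walk_sum -sumrN; apply: eq_bigr => -[e []] _ //=.
by rewrite opprK.
Qed.

(** The classes of closed walks at u form a subgroup H.  It contains the class of
    every cycle x: for a choice of walks q from u to all vertices, each edge
    closes up to a loop at u through q, and in the sum of these loops with
    coefficients x the contributions of q cancel because x is a cycle.  Cycles
    realize a basis of the lattice, so H is everything. *)
Lemma walk_of_class (torusG : embedded_in_torus G) u v (c : lattice) :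
  exists p, is_walk u p v /\ walk_class p = c.
Proof.
pose H c0 := exists p, is_walk u p u /\ walk_class p = c0.
have H0 : H 0 by exists [::]; rewrite /= eqxx walk_classE /walk_sum big_nil.
have HD c1 c2 : H c1 -> H c2 -> H (c1 + c2).
  move=> [p1 [wp1 <-]] [p2 [wp2 <-]]; exists (p1 ++ p2).
  by rewrite !walk_classE walk_sum_cat (is_walk_cat wp1 wp2).
have HN c1 : H c1 -> H (- c1).
  move=> [p1 [wp1 <-]]; exists (rev_walk p1).
  by rewrite !walk_classE walk_sum_rev is_walk_rev.
have HMn c1 k : H c1 -> H (c1 *+ k).
  by move=> Hc1; elim: k => // k IHk; rewrite mulrS; apply: HD.
have HMz c1 k : H c1 -> H (c1 *~ k).
  by move=> Hc1; case: k => k; [exact: HMn | apply: HN; exact: HMn].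
have /choice[q walk_q] := torus_connected torusG u.
have Hcycle (x : edge G -> int) : cycle1 x -> H (cycle_class x).
  case=> xb xw; pose c0 v0 := walk_class (q v0).
  have -> : cycle_class x =
      \sum_e (c0 (inl (bl e)) + loop e - c0 (inr (wh e))) *~ x e.
    under [RHS]eq_bigr do rewrite mulrzBl mulrzDl.
    rewrite sumrB big_split /=.
    rewrite (partition_big (@bl G) xpredT) //= big1 ?add0r => [|b _]; last first.
      transitivity (\sum_(e | bl e == b) c0 (inl b) *~ x e).
        by apply: eq_bigr => e /eqP ->.
      by rewrite -mulrz_sumr xb.
    rewrite [X in _ = _ - X](partition_big (@wh G) xpredT) //=.
    rewrite [X in _ = _ - X]big1 ?subr0 // => w _.
    transitivity (\sum_(e | wh e == w) c0 (inr w) *~ x e).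
      by apply: eq_bigr => e /eqP ->.
    by rewrite -mulrz_sumr xw.
  apply: (big_ind H) => // e _; apply: HMz.
  exists (q (inl (bl e)) ++ [:: (e, true)] ++ rev_walk (q (inr (wh e)))).
  rewrite !walk_classE !walk_sum_cat walk_sum_rev walk_sum_edge addrA; split=> //.
  apply: is_walk_cat (walk_q _) (is_walk_cat (is_walk_edge e) _).
  exact: is_walk_rev.
case: (torus_basis torusG) => gz [gw [[/Hcycle Hz /Hcycle Hw] zE wE _]].
rewrite zE in Hz; rewrite wE in Hw.
have [p [walk_p pE]] : H (c - walk_class (q v)).
  have -> : c - walk_class (q v) = (1, 0) *~ (c - walk_class (q v)).1 +
      (0, 1) *~ (c - walk_class (q v)).2.
    by rewrite !lattice_mulrz; case: (c - _) => i j; congr pair => /=; ring.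
  by apply: HD; apply: HMz.
exists (p ++ q v); split; first exact: is_walk_cat walk_p (walk_q v).
by rewrite walk_classE walk_sum_cat -!walk_classE pE subrK.
Qed.

End Walks.

(** * Crossings with a zig-zag path *)

Section Zigzags.
Variable G : ribbon_graph.
Implicit Types (a : {set dart G}) (d : dart G) (x y : ldart G).

Lemma zigzag_step_inj : injective (@zigzag_step G).
Proof.
pose back d := if d.2 then (@prevb G d.1, false) else (@nextw G d.1, true).
apply: (can_inj (g := back)) => -[e []]; rewrite /zigzag_step /back /=.
  by rewrite prevwK.
by rewrite nextbK.
Qed.

Lemma zigzagP a : a \in zigzags G ->
  exists d, a = [set d' | fconnect (@zigzag_step G) d d'].
Proof. by case/imsetP=> d _ ->; exists d. Qed.

Lemma mem_zigzag_step a d : a \in zigzags G -> (zigzag_step d \in a) = (d \in a).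
Proof.
by case/zigzagP=> d0 ->; rewrite !inE -same_fconnect1_r //; exact: zigzag_step_inj.
Qed.

Definition zigzag_chain a : edge G -> int :=
  fun e => ((e, true) \in a)%:Z - ((e, false) \in a)%:Z.

Lemma zigzag_chain_class a : cycle_class (zigzag_chain a) = zclass a.
Proof.
rewrite /zclass big_mkcond /=.
rewrite (eq_bigr (fun d => (fun e b =>
  if (e, b) \in a then dclass (e, b) else 0) d.1 d.2)); last by case.
rewrite -(pair_bigA _ (fun e b => if (e, b) \in a then dclass (e, b) else 0)) /=.
apply: eq_bigr => e _; rewrite big_bool /zigzag_chain /dclass /=.
by case: (_ \in a); case: (_ \in a);
  rewrite ?subrr ?subr0 ?sub0r ?mulr0z ?mulrNz ?mulr1z ?addr0 ?add0r ?subrr.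
Qed.

Lemma mem_zigzag_nextb a e : a \in zigzags G ->
  ((e, false) \in a) = ((nextb e, true) \in a).
Proof. by move=> Za; rewrite -(mem_zigzag_step (e, false) Za). Qed.

Lemma mem_zigzag_nextw a e : a \in zigzags G ->
  ((e, false) \in a) = ((nextw e, true) \in a).
Proof.
by move=> Za; rewrite -(mem_zigzag_step (nextw e, true) Za) /zigzag_step /= nextwK.
Qed.

Lemma zigzag_chain_cycle a : a \in zigzags G -> cycle1 (zigzag_chain a).
Proof.
move=> Za; split=> v; rewrite /zigzag_chain.
- under eq_bigr do rewrite mem_zigzag_nextb //.
  exact: (sum_turn (@bstar_uniq G) (@mem_bstar G) (fun e => ((e, true) \in a)%:Z)).
- under eq_bigr do rewrite mem_zigzag_nextw //.
  exact: (sum_turn (@wstar_uniq G) (@mem_wstar G) (fun e => ((e, true) \in a)%:Z)).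
Qed.

(** A zig-zag path that runs backwards along e comes from [nextw e] and goes on
    to [nextb e], which it follows forwards.  So its
    chain is a difference, around the black and around the white vertices, of
    the same function g, and [star_form_turn] applies twice. *)
Lemma intersection2_zigzag a (y : edge G -> int) : a \in zigzags G -> cycle1 y ->
  intersection2 (zigzag_chain a) y = - 2 * \sum_e passes a e * y e.
Proof.
move=> Za [yb yw]; pose g e := ((e, true) \in a)%:Z.
have chainb : zigzag_chain a = fun e => g e - g (rotate (@bl G) (@bstar G) e).
  by apply: funext => e; rewrite /zigzag_chain mem_zigzag_nextb.
have chainw : zigzag_chain a = fun e => g e - g (rotate (@wh G) (@wstar G) e).
  by apply: funext => e; rewrite /zigzag_chain mem_zigzag_nextw.
rewrite intersection2E {1}chainb chainw.
rewrite (star_form_turn (@bstar_uniq G) (@mem_bstar G)) //.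
rewrite (star_form_turn (@wstar_uniq G) (@mem_wstar G)) //.
rewrite -opprD -big_split mulNr mulr_sumr; congr (- _); apply: eq_bigr => e _.
rewrite /passes {1}mem_zigzag_nextb //=.
have -> : g (rotate (@wh G) (@wstar G) e) = g (nextb e).
  by rewrite /g -mem_zigzag_nextb // mem_zigzag_nextw.
by rewrite -/(g _) -/(g (nextb e)) -[rotate _ _ e]/(nextb e); ring.
Qed.

(** The crossing number of a closed walk with a zig-zag path is homological. *)
Lemma zigzag_crossings a p v : embedded_in_torus G -> a \in zigzags G ->
  is_walk v p v -> crossings a p = cross (zclass a) (walk_class p).
Proof.
move=> torusG Za walk_p; have cyc_p := walk_chain_cycle walk_p.
have := intersection2_class torusG (zigzag_chain_cycle Za) cyc_p.
rewrite intersection2_zigzag // zigzag_chain_class.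
have <- : walk_class p = cycle_class (walk_chain p) by exact: walk_sum_chain.
rewrite crossingsE walk_sum_chain => eq2.
under eq_bigr do rewrite mulrzz.
by move: (\sum_e _) (cross _ _) eq2 => s c /=; lia.
Qed.

(** * Minimality *)

(** In a minimal graph no two intersections of two strands, consecutive or not,
    have both strands oriented from the first to the second.  Let x' be the
    first intersection after x on one strand.  If the other strand goes from x
    to x', then x and x' bound a parallel bigon; if it goes from x' to x, then
    both strands are oriented from x' to y and x can be replaced by x'. *)
Lemma no_parallel_crossings i j x y : minimal G -> y <> x ->
  (forall k, (k < i)%N -> iter k (@lift_step G) x <> y) ->
  iter i (@lift_step G) x = y -> iter j (@lift_step G) (flip x) = flip y -> False.
Proof.
move=> [_ no_bigon]; have [m] := ubnP i; elim: m i j x => // m IHm i j x lt_im.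
move=> ne_yx first_y xy flip_xy.
have [[k]|none] := pselect (exists k, (0 < k < i)%N &&
    `[< same_lift (flip x) (flip (iter k (@lift_step G) x)) >]); last first.
  apply: (no_bigon x y); exists i, j; split=> // k k_i meet.
  by apply: none; exists k; rewrite k_i; apply/asboolP.
move=> k_meet; have ex_k : exists k, (0 < k < i)%N &&
    `[< same_lift (flip x) (flip (iter k (@lift_step G) x)) >] by exists k.
case: (ex_minnP ex_k) => {k_meet ex_k} {}k /andP[/andP[k_gt0 k_lt] /asboolP meet] min_k.
set x' := iter k _ x in meet.
have x'y : iter (i - k) (@lift_step G) x' = y by rewrite -iterD subnK // ltnW.
case: meet => -[t flip_x'].
- apply: (no_bigon x x'); exists k, t; split=> // [x'x | k' /andP[k'_gt0 k'_lt] meet'].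
    apply: (first_y (i - k)%N); last by rewrite -{1}x'x.
    by rewrite ltn_subrL k_gt0 (leq_ltn_trans _ k_lt).
  have := min_k k'; rewrite k'_gt0 (ltn_trans k'_lt k_lt) /= leqNgt k'_lt.
  by move=> /(_ (asboolT meet')).
- apply: (IHm (i - k)%N (j + t)%N x') => //.
  + rewrite (leq_trans _ (lt_im : (i <= m)%N)) //.
    by rewrite ltn_subrL k_gt0 (leq_ltn_trans _ k_lt).
  + by move=> yx'; apply: (first_y k).
  + by move=> k' lt_k'; rewrite -iterD; apply: first_y; lia.
  + by rewrite iterD flip_x'.
Qed.

(** The translate of R that contains the source of a lifted dart.  Unlike the
    second component of the dart, it changes at each step of a zig-zag path by
    the class of the dart. *)
Definition lift_source x : lattice := if x.1.2 then x.2 else x.2 + loop x.1.1.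

Lemma iter_lift_step k x :
  (iter k (@lift_step G) x).1 = iter k (@zigzag_step G) x.1 /\
  lift_source (iter k (@lift_step G) x) =
  lift_source x + \sum_(i < k) dclass (iter i (@zigzag_step G) x.1).
Proof.
elim: k => [|k [IH1 IH2]]; first by rewrite big_ord0 addr0.
rewrite big_ord_recr /= addrA -IH2 -IH1; split=> //.
case: (iter k (@lift_step G) x) => -[e []] c; rewrite /lift_source /lift_step /dclass /=.
  by rewrite subrK.
by rewrite addrK.
Qed.

Lemma sum_zigzag a d (V : zmodType) (F : dart G -> V) : a \in zigzags G -> d \in a ->
  \sum_(i < fingraph.order (@zigzag_step G) d) F (iter i (@zigzag_step G) d) =
  \sum_(d' in a) F d'.
Proof.
move=> Za da; have aE d' : (d' \in a) = (d' \in orbit (@zigzag_step G) d).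
  case/zigzagP: Za da => d0 ->; rewrite !inE -fconnect_orbit => d0d.
  by apply: same_connect d0d d'; apply: fconnect_sym zigzag_step_inj.
rewrite (eq_bigl _ _ aE) -big_uniq ?orbit_uniq //= (big_nth d) size_orbit big_mkord.
by apply: eq_bigr => i _; rewrite nth_traject.
Qed.

Lemma iter_lift_period a x : a \in zigzags G -> x.1 \in a ->
  iter (fingraph.order (@zigzag_step G) x.1) (@lift_step G) x =
  (x.1, x.2 + zclass a).
Proof.
move=> Za xa; set k := fingraph.order _ _.
have [] := iter_lift_step k x; rewrite (sum_zigzag (@dclass G) Za xa).
rewrite iter_order; last exact: zigzag_step_inj.
case: x @k xa => d c k xa; case: (iter k _ _) => d' c' /= -> srcE; congr pair.
move: srcE; rewrite /lift_source /=; case: d.2 => //.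
by rewrite addrAC => /addIr.
Qed.

(** If a ran through e in both directions, two lifts of a would cross at a lift of
    e.  Both are invariant under the translation by the class of a, so they
    would cross again at the translated edge, which is another one as the class
    is not 0, in the direction of both. *)
Lemma passes_le1 a e : minimal G -> a \in zigzags G -> zclass a != 0 ->
  passes a e <= 1.
Proof.
move=> minG Za a0; rewrite /passes.
case e1: ((e, true) \in a); case e0: ((e, false) \in a) => //; exfalso.
(* The sum 0 + zclass a is kept in the form given by [iter_lift_period]. *)
pose x : ldart G := ((e, true), 0); pose y : ldart G := ((e, true), 0 + zclass a).
have yP : exists k, iter k (@lift_step G) x == y.
  by exists (fingraph.order (@zigzag_step G) x.1); rewrite (iter_lift_period Za).
case: (ex_minnP yP) => i /eqP xy min_i.
apply: (no_parallel_crossings (i := i) minG _ _ xy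
  (iter_lift_period (x := flip x) Za e0)) => [yx | k lt_ki /eqP /min_i].
  by move/eqP: a0; apply; rewrite -[LHS]add0r; exact: (congr1 snd yx).
by rewrite leqNgt lt_ki.
Qed.

Lemma visits_of_passes a e : a \in zigzags G -> passes a e != 0 ->
  visits a (inl (bl e)).
Proof.
move=> Za; rewrite /passes.
case e1: ((e, true) \in a).
  by move=> _; apply/existsP; exists (e, true); rewrite e1 /dsrc /=.
case e0: ((e, false) \in a) => // _.
apply/existsP; exists (nextb e, true).
by rewrite -mem_zigzag_nextb // e0 /dsrc /= bl_nextb.
Qed.

End Zigzags.

(** * Sections given by Laurent polynomials *)

Section LaurentSections.
Variables (R : realType) (N : set (R * R)) (S : normal_fan N).
Local Notation n := (nrays S).
Implicit Types (z lam : Defs.point S) (k : 'I_n -> int).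

Lemma monomialD k1 k2 z : in_torus z ->
  monomial (fun rho => k1 rho + k2 rho) z = monomial k1 z * monomial k2 z.
Proof.
move=> z0; rewrite /monomial -big_split; apply: eq_bigr => rho _ /=.
exact: expfzDr.
Qed.

Lemma prodfXz (F : fieldType) (I : finType) (x : I -> F) (m : int) :
  (\prod_i x i) ^ m = \prod_i x i ^ m.
Proof. by apply: (big_morph (fun y => y ^ m)) => [u v|]; rewrite ?expfzMl ?exp1rz. Qed.

Lemma eq_monomial k1 k2 z : k1 =1 k2 -> monomial k1 z = monomial k2 z.
Proof. by move=> eqk; apply: eq_bigr => rho _; rewrite eqk. Qed.

Lemma monomial_scale k lam z :
  monomial k (scale lam z) = monomial k lam * monomial k z.
Proof.
rewrite /monomial -big_split; apply: eq_bigr => rho _ /=.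
by rewrite ffunE expfzMl.
Qed.

(** The exponents of the pullback of the character chi^m to U_Sigma. *)
Definition char_exponent (m : lattice) : 'I_n -> int :=
  fun rho => (elen S rho)%:Z * pairing m (ray S rho).

Lemma chi_to_T (m : lattice) z : in_torus z ->
  chi m (to_T z) = monomial (char_exponent m) z.
Proof.
move=> z0; rewrite /chi /= /monomial !prodfXz -big_split.
apply: eq_bigr => rho _ /=.
rewrite !exprz_exp -expfzDr //; congr (_ ^ _).
by rewrite /char_exponent /pairing /=; ring.
Qed.

Lemma hom_section_laurent (I : finType) (P : pred I) (c : I -> R[i])
    (m : I -> lattice) (b b' : 'I_n -> int) :
  (forall i, P i ->
     forall rho, 0 <= char_exponent (m i) rho + (b' rho - b rho)) ->
  exists f : Defs.point S -> R[i], hom_section b b' f /\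
    forall z, in_torus z ->
      f z * monomial b z =
      (\sum_(i | P i) c i * chi (m i) (to_T z)) * monomial b' z.
Proof.
move=> nneg; pose k i rho := char_exponent (m i) rho + (b' rho - b rho).
have kE i z : in_torus z ->
    monomial (k i) z * monomial b z = monomial (char_exponent (m i)) z * monomial b' z.
  move=> z0; rewrite -!monomialD //; apply: eq_monomial => rho.
  by rewrite /k; ring.
exists (fun z => \sum_(i | P i) c i * monomial (k i) z); split; [split|].
- move=> sigma _; exists [seq (c i, [ffun rho => k i rho]) | i <- enum P]; split.
    apply/allP => _ /mapP[i Pi ->]; apply/forall_inP => rho _ /=.
    by rewrite ffunE; apply: nneg; rewrite mem_enum in Pi.
  move=> z _; rewrite big_map big_enum; apply: eq_bigr => i _ /=.
  by congr (_ * _); apply: eq_monomial => rho; rewrite ffunE.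
- move=> lam z [lam0 lam1] _; rewrite mulr_suml mulr_sumr; apply: eq_bigr => i _.
  rewrite monomial_scale mulrA mulrAC -(mulrA (c i)) kE //.
  by rewrite /char_exponent lam1 mul1r -mulrA mulrCA.
- move=> z z0; rewrite !mulr_suml; apply: eq_bigr => i _.
  by rewrite chi_to_T // -!mulrA kE.
Qed.

End LaurentSections.

(** * Positivity of the exponents *)

Section Exponents.
Variables (R : realType) (G : ribbon_graph) (S : normal_fan (newton_polygon R G)).
Hypotheses (torusG : embedded_in_torus G) (minG : minimal G)
  (edgesN : edge_vectors_are_zigzags S).
Local Notation n := (nrays S).

Lemma card_Z_rho (rho : 'I_n) : #|Z_rho rho| = elen S rho.
Proof.
rewrite /Z_rho edgesN (bigD1 rho) //= big1 ?addn0 // => r /andP[/eqP eq_dir /eqP[]].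
apply: ray_inj; case: eq_dir.
by case: (ray S r) (ray S rho) => [p q] [p' q'] /= -> /oppr_inj ->.
Qed.

Lemma ccw_dir_ray_neq0 (rho : 'I_n) : ccw_dir (ray S rho) != 0.
Proof.
have /rayP[+ _] : exists r, ray S r = ray S rho by exists rho.
apply: contraL; case: (ray S rho) => p q /eqP[/= -> /eqP].
by rewrite oppr_eq0 => /eqP ->.
Qed.

Lemma cross_ccw_dir (u c : lattice) : cross (ccw_dir u) c = pairing c u.
Proof. by rewrite /cross /pairing /=; ring. Qed.

Lemma passes_le_visits a e rho : a \in @Z_rho R G S rho ->
  passes a e <= (visits a (inl (bl e)))%:Z.
Proof.
rewrite inE => /andP[Za /eqP aE].
have [-> // | /visits_of_passes -> //] := eqVneq (passes a e) 0.
by apply: passes_le1 => //; rewrite aE ccw_dir_ray_neq0.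
Qed.

(** The crossing number of the closed walk r of class l_e gives, for each a in
    Z_rho, crossings a q = crossings a p - passes a e - <l_e, u_rho>.  Summed over
    Z_rho, the last term cancels the exponent of the character l_e. *)
Lemma edge_exponent_ge0 (u0 : vertex G) (e : edge G) p q (rho : 'I_n) :
  is_walk u0 p (inl (bl e)) -> walk_class p = 0 ->
  is_walk u0 q (inr (wh e)) -> walk_class q = 0 ->
  0 <= char_exponent (loop e) rho +
    (\sum_(a in Z_rho rho) crossings a q -
     (\sum_(a in Z_rho rho) crossings a p -
      \sum_(a in Z_rho rho) (visits a (inl (bl e)))%:Z)).
Proof.
move=> walk_p p0 walk_q q0.
pose r := p ++ [:: (e, true)] ++ rev_walk q.
have walk_r : is_walk u0 r u0.
  exact: is_walk_cat walk_p (is_walk_cat (is_walk_edge e) (is_walk_rev walk_q)).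
have class_r : walk_class r = loop e.
  rewrite !walk_classE /r !walk_sum_cat walk_sum_rev walk_sum_edge.
  by rewrite -!walk_classE p0 q0 add0r subr0.
have crossE a : a \in Z_rho rho ->
    crossings a q = crossings a p - passes a e - pairing (loop e) (ray S rho).
  rewrite inE => /andP[Za /eqP aE].
  rewrite -cross_ccw_dir -aE -class_r -(zigzag_crossings torusG Za walk_r).
  by rewrite !crossingsE /r !walk_sum_cat walk_sum_rev walk_sum_edge; ring.
rewrite (eq_bigr _ crossE) !sumrB sumr_const card_Z_rho.
rewrite /char_exponent -mulr_natl natz.
have : \sum_(a in Z_rho rho) passes a e <=
    \sum_(a in Z_rho rho) (visits a (inl (bl e)))%:Z.
  by apply: ler_sum => a; exact: passes_le_visits.
rewrite -subr_ge0 => /le_trans -> //.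
by rewrite le_eqVlt; apply/orP; left; apply/eqP; ring.
Qed.

End Exponents.

Theorem proposition5p1 (R : realType) (G : ribbon_graph)
  (torusG : embedded_in_torus G) (minG : minimal G)
  (S : normal_fan (newton_polygon R G))
  (intN : (interior (newton_polygon R G) !=set0)%classic)
  (edgesN : edge_vectors_are_zigzags S)
  (wt eps : edge G -> R[i]) (wt_neq0 : forall e, wt e != 0)
  (eps_sign : kasteleyn_sign eps)
  (w0 : white G) (D : vertex G -> divisor S) (abelD : abel_map w0 D) :
  extends (calE D) (calF D) (kasteleyn wt eps).
Proof.
have /choice[q walk_q] : forall v : vertex G,
    exists p, is_walk (inr w0) p v /\ walk_class p = 0.
  by move=> v; exact: walk_of_class.
case: abelD => D0 abelD.
(* |E_rho| times the Abel map, written as an integer. *)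
pose wgt v (rho : 'I_(nrays S)) : int := \sum_(a in Z_rho rho) crossings a (q v).
have DE v rho : D v rho = (wgt v rho)%:~R / (elen S rho)%:R.
  have [walk_v v0] := walk_q v.
  rewrite -[LHS]subr0 -(D0 rho) (abelD _ _ _ walk_v v0).
  by rewrite -mulr_suml /wgt rmorph_sum.
pose wgtE b rho : int :=
  wgt (inl b) rho - \sum_(a in Z_rho rho) (visits a (inl b))%:Z.
exists wgtE, (fun w => wgt (inr w)); split=> [b rho | w rho |].
- rewrite /calE DE intrB mulrBl; congr (_ - _).
  rewrite -mulr_suml; congr (_ / _); rewrite rmorph_sum big_mkcondr.
  by apply: eq_bigr => a _; case: ifP => _ /=.
- exact: DE.
have entry (wb : white G * black G) : exists f : Defs.point S -> R[i],
    hom_section (wgtE wb.2) (wgt (inr wb.1)) f /\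
    forall z, in_torus z -> f z * monomial (wgtE wb.2) z =
      kasteleyn wt eps wb.1 wb.2 (to_T z) * monomial (wgt (inr wb.1)) z.
  apply: hom_section_laurent => e /andP[/eqP <- /eqP <-] rho.
  have [walk_b b0] := walk_q (inl (bl e)).
  have [walk_w w_0] := walk_q (inr (wh e)).
  exact: (edge_exponent_ge0 torusG minG edgesN rho walk_b b0 walk_w w_0).
have [Kt KtP] := choice entry.
exists (fun w b => Kt (w, b)); split=> w b; first exact: (KtP (w, b)).1.
exact: (KtP (w, b)).2.
Qed.
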